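(* Let $\alpha\in\{132,213,231,312\}$. Then (each sequence below being indexed from $n=0$ and equal to $0$ beyond the listed terms): (i) $\{s_n^0(123,\alpha,321)\}_{n\ge 0}=1,0,1,2,1,0,0,\dots$ if $\alpha\ne 231,312$; (ii) $\{s_n^0(123,\alpha,321)\}_{n\ge 0}=1,0,1,1,1,0,0,\dots$ if $\alpha=231$ or $\alpha=312$; (iii) $\{s_n^1(123,\alpha,321)\}_{n\ge 0}=0,1,0,2,0,0,\dots$ if $\alpha\ne 132,213$; (iv) $\{s_n^1(123,\alpha,321)\}_{n\ge 0}=0,1,0,1,0,0,\dots$ if $\alpha=132$ or $\alpha=213$; (v) $\{s_n^2(123,\alpha,321)\}_{n\ge 0}=0,0,1,0,0,\dots$ for any $\alpha$; (vi) $s_n^k(123,\alpha,321)=0$ for any $\alpha$ and all $3\le k\le n$.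
   Context: $S_n$ denotes the set of permutations of $\{1,\dots,n\}$ written in one-line notation $\pi=\pi_1\pi_2\cdots\pi_n$ ($S_0$ consists of the single empty permutation). For $\alpha\in S_m$, $\pi\in S_n$ contains the pattern $\alpha$ if there are indices $i_1<i_2<\dots<i_m$ such that $\pi_{i_1}\pi_{i_2}\cdots\pi_{i_m}$ is order-isomorphic to $\alpha$; otherwise $\pi$ avoids $\alpha$. For a set $T$ of patterns, $S_n^k(T)$ is the set of $\pi\in S_n$ that have exactly $k$ fixed points (indices $i$ with $\pi_i=i$) and avoid every pattern in $T$; $s_n^k(T)=|S_n^k(T)|$, and $s_n^k(T)=0$ if $k<0$ or $k>n$. The braces around $T$ are omitted, e.g. $s_n^k(123,\alpha,321)=s_n^k(\{123,\alpha,321\})$. *)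

(* Defs.v *)
From mathcomp Require Import all_boot all_fingroup.
From mathcomp Require Import finmap.

Set Implicit Arguments.
Unset Strict Implicit.
Unset Printing Implicit Defensive.

(* 'S_n permutes {0, ..., n-1}; the shift of {1, ..., n} by one changes neither
   pattern containment nor fixed points. Only one_line and of_word below use
   the 1-based values. *)

Definition one_line (n : nat) (pi : 'S_n) : seq nat :=
  [seq (pi i).+1 | i <- enum 'I_n].

(* The permutation with one-line notation w; meaningful only when w is a
   permutation of 1, ..., n (see one_line_of_word). *)
Definition of_word (n : nat) (w : seq nat) : 'S_n :=
  insubd (1%g : 'S_n)
    [ffun i : 'I_n => insubd i (nth 0 w i).-1 : 'I_n].

Definition contains (m n : nat) (alpha : 'S_m) (pi : 'S_n) : bool :=
  [exists f : {ffun 'I_m -> 'I_n},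
    [forall a : 'I_m, forall b : 'I_m, (a < b) ==> (f a < f b)] &&
    [forall a : 'I_m, forall b : 'I_m, (pi (f a) < pi (f b)) == (alpha a < alpha b)]].

Definition avoids (m n : nat) (alpha : 'S_m) (pi : 'S_n) : bool :=
  ~~ contains alpha pi.

(* Permutations of arbitrary length, so that a set of patterns may mix
   lengths. *)
Definition pattern : Type := {m : nat & 'S_m}.

Definition fixed_points (n : nat) (pi : 'S_n) : {set 'I_n} :=
  [set i | pi i == i].

Definition S_ (n k : nat) (T : {fset pattern}) : {set 'S_n} :=
  [set pi : 'S_n | (#|fixed_points pi| == k) &&
                   [forall tau : T, avoids (tagged (val tau)) pi]].

Definition s_ (n k : nat) (T : {fset pattern}) : nat := #|S_ n k T|.

Definition word_pattern (n : nat) (w : seq nat) : pattern :=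
  Tagged (fun m => 'S_m) (of_word n w).

Definition p123 : pattern := word_pattern 3 [:: 1; 2; 3].
Definition p132 : pattern := word_pattern 3 [:: 1; 3; 2].
Definition p213 : pattern := word_pattern 3 [:: 2; 1; 3].
Definition p231 : pattern := word_pattern 3 [:: 2; 3; 1].
Definition p312 : pattern := word_pattern 3 [:: 3; 1; 2].
Definition p321 : pattern := word_pattern 3 [:: 3; 2; 1].

Lemma one_line_of_word (n : nat) (w : seq nat) :
  perm_eq w (iota 1 n) -> one_line (of_word n w) = w.
Proof.
move=> pw.
have sw : size w = n by rewrite (perm_size pw) size_iota.
have uw : uniq w by rewrite (perm_uniq pw) iota_uniq.
have rw i : i < n -> 0 < nth 0 w i <= n.
  move=> lt_in; have : nth 0 w i \in iota 1 n.
    by rewrite -(perm_mem pw) mem_nth ?sw.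
  by rewrite mem_iota add1n ltnS.
pose f := [ffun i : 'I_n => insubd i (nth 0 w i).-1 : 'I_n].
have fE (i : 'I_n) : (f i).+1 = nth 0 w i.
  have /andP[w_gt0 w_le] := rw i (ltn_ord i).
  by rewrite ffunE val_insubd prednK // w_le prednK.
have f_inj : injectiveb f.
  apply/injectiveP => i j eq_f; apply/val_inj/eqP.
  by rewrite /= -(nth_uniq 0 _ _ uw) ?sw // -!fE eq_f.
have oE (i : 'I_n) : (of_word n w i).+1 = nth 0 w i.
  rewrite -(fE i) /of_word -/f; congr (nat_of_ord _).+1.
  by rewrite -pvalE; have /= -> := @insubdK _ _ _ (1%g : 'S_n) f f_inj.
apply: (@eq_from_nth _ 0); rewrite /one_line size_map size_enum_ord ?sw //.
move=> i lt_in; rewrite (nth_map (Ordinal lt_in)) ?size_enum_ord // oE.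
by rewrite nth_enum_ord.
Qed.

(* Main.v *)
Require Import Defs.
From mathcomp Require Import all_boot all_fingroup.
From mathcomp Require Import finmap.

Set Implicit Arguments.
Unset Strict Implicit.
Unset Printing Implicit Defensive.

Local Open Scope fset_scope.

(** By the Erdos-Szekeres argument every permutation of length at least 5
    contains 123 or 321 ([monotone_triple]), so every sequence vanishes from
    n = 5 on.  Three fixed points form an occurrence of 123, which gives the
    vanishing for k >= 3 at every length ([fixed_points_le2]).

    What is left is finite.  At n = 3 only the pattern alpha itself is removed
    from 132, 213 (one fixed point each) and 231, 312 (none).  At n = 4 the
    words avoiding 123 and 321 are 2143, 2413, 3142 and 3412, without fixed
    points; 2143 contains exactly 132 and 213 among the four choices of alpha,
    3412 exactly 231 and 312, the other two contain all four, so one word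
    survives for each alpha.  These values are obtained by evaluation:
    permutations correspond to the rearrangements of 1, ..., n through their
    one-line notation ([card_one_line]), on which containment of a pattern of
    length 3 and the number of fixed points are computable
    ([contains_one_line], [card_fixed_points]), and n <= 4 leaves at most 24
    words to run through. *)

(** * Occurrences of patterns of length 3 *)

(** For distinct entries these three comparisons determine the order type. *)
Definition shape (s : seq nat) (i j k : nat) : bool * bool * bool :=
  (nth 0 s i < nth 0 s j, nth 0 s i < nth 0 s k, nth 0 s j < nth 0 s k).

(** The quantifiers run over explicit lists so that the predicate reduces to a
    boolean on concrete words. *)
Definition word_contains (w s : seq nat) : bool :=
  has (fun k => has (fun j => has (fun i => shape s i j k == shape w 0 1 2)
    (iota 0 j)) (iota 0 k)) (iota 0 (size s)).

Lemma size_one_line n (pi : 'S_n) : size (one_line pi) = n.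
Proof. by rewrite size_map size_enum_ord. Qed.

Lemma nth_one_line n (pi : 'S_n) (i : 'I_n) :
  nth 0 (one_line pi) i = (pi i).+1.
Proof. by rewrite (nth_map i) ?size_enum_ord // nth_ord_enum. Qed.

Lemma shape_one_line n (pi : 'S_n) (i j k : 'I_n) :
  shape (one_line pi) i j k = (pi i < pi j, pi i < pi k, pi j < pi k).
Proof. by rewrite /shape !nth_one_line !ltnS. Qed.

Lemma word_containsP n (w : seq nat) (pi : 'S_n) :
  reflect (exists i j k : 'I_n,
             [/\ i < j, j < k & shape (one_line pi) i j k = shape w 0 1 2])
          (word_contains w (one_line pi)).
Proof.
apply: (iffP hasP) => [[k] | [i] [j] [k] [lt_ij lt_jk eq_shape]].
  rewrite mem_iota size_one_line /= add0n => lt_kn.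
  case/hasP=> j; rewrite mem_iota /= add0n => lt_jk.
  case/hasP=> i; rewrite mem_iota /= add0n => lt_ij /eqP eq_shape.
  have lt_jn := ltn_trans lt_jk lt_kn.
  by exists (Ordinal (ltn_trans lt_ij lt_jn)), (Ordinal lt_jn), (Ordinal lt_kn).
exists (k : nat); first by rewrite mem_iota size_one_line /=.
apply/hasP; exists (j : nat); first by rewrite mem_iota.
by apply/hasP; exists (i : nat); [rewrite mem_iota | apply/eqP].
Qed.

Lemma perm_ltNge n (pi : 'S_n) (i j : 'I_n) :
  i != j -> (pi i < pi j) = ~~ (pi j < pi i).
Proof.
move=> neq_ij; rewrite -leqNgt ltn_neqAle.
by rewrite (inj_eq val_inj) (inj_eq perm_inj) neq_ij.
Qed.

Lemma contains_one_line n (alpha : 'S_3) (pi : 'S_n) :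
  contains alpha pi = word_contains (one_line alpha) (one_line pi).
Proof.
pose o0 := @Ordinal 3 0 isT; pose o1 := @Ordinal 3 1 isT.
pose o2 := @Ordinal 3 2 isT.
have shape_alpha : shape (one_line alpha) 0 1 2
    = (alpha o0 < alpha o1, alpha o0 < alpha o2, alpha o1 < alpha o2).
  exact: (shape_one_line alpha o0 o1 o2).
apply/existsP/word_containsP => [[f /andP[/forallP incr /forallP iso]] |].
  have incrE (a b : 'I_3) : a < b -> f a < f b by move/forallP: (incr a) => /(_ b)/implyP.
  have isoE (a b : 'I_3) : (pi (f a) < pi (f b)) = (alpha a < alpha b).
    by have /forallP/(_ b)/eqP := iso a.
  exists (f o0), (f o1), (f o2); split; [exact: incrE | exact: incrE |].
  by rewrite shape_one_line shape_alpha !isoE.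
case=> i [j] [k] [lt_ij lt_jk]; rewrite shape_one_line shape_alpha.
case=> eq01 eq02 eq12.
have lt_ik := ltn_trans lt_ij lt_jk.
pose f := [ffun a : 'I_3 => nth k [:: i; j; k] a].
have neq (a b : 'I_n) : a < b -> a != b by rewrite ltn_neqAle => /andP[].
(* Equality of the strict comparisons for a < b is enough: the ones for b < a
   are their negations, as alpha and pi are injective. *)
have iso (a b : 'I_3) : a < b ->
    (f a < f b) && ((pi (f a) < pi (f b)) == (alpha a < alpha b)).
  case: a => [[|[|[|//]]] lta]; case: b => [[|[|[|//]]] ltb] //= _;
    rewrite !ffunE /= ?lt_ij ?lt_ik ?lt_jk ?eq01 ?eq02 ?eq12 /=;
    by apply/eqP; congr (_ < _); congr (nat_of_ord (alpha _)); apply: val_inj.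
exists f; apply/andP; split; apply/forallP=> a; apply/forallP=> b.
  by apply/implyP=> /iso/andP[].
case: (ltngtP a b) => [/iso/andP[] // | lt_ba | /val_inj->]; last by rewrite !ltnn.
have /andP[lt_f /eqP eq_f] := iso b a lt_ba.
rewrite perm_ltNge 1?eq_sym ?neq // eq_f -perm_ltNge 1?eq_sym //.
by rewrite -(inj_eq val_inj) ltn_eqF.
Qed.

(** * Monotone triples *)

(** Each position is labelled by whether a smaller, and whether a larger, entry
    precedes it.  With four labels and at least five positions, two positions
    i < j share a label; if the entry at i is the smaller one then j, hence also
    i, has a smaller entry before it, which completes an occurrence of 123, and
    the other case gives 321. *)
Lemma monotone_triple n (pi : 'S_n) : 4 < n ->
  word_contains [:: 1; 2; 3] (one_line pi)
  || word_contains [:: 3; 2; 1] (one_line pi).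
Proof.
move=> n_gt4.
pose up (i : 'I_n) := [exists h : 'I_n, (h < i) && (pi h < pi i)].
pose down (i : 'I_n) := [exists h : 'I_n, (h < i) && (pi i < pi h)].
pose label i := (up i, down i).
have /injectivePn[x [y neq_xy eq_label]] : ~~ injectiveb label.
  apply/negP=> /injectiveP/leq_card.
  by rewrite card_ord card_prod !card_bool leqNgt n_gt4.
wlog lt_xy : x y neq_xy eq_label / x < y => [IH|].
  case: (ltngtP x y) => [lt_xy | lt_yx | /val_inj eq_xy].
  - exact: IH lt_xy.
  - by apply: (IH y x) => //; rewrite eq_sym.
  - by rewrite eq_xy eqxx in neq_xy.
case: eq_label => eq_up eq_down.
have [lt_pi | le_pi] := ltnP (pi x) (pi y).
  have /existsP[h /andP[lt_hx lt_pih]] : up x.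
    by rewrite eq_up; apply/existsP; exists x; rewrite lt_xy.
  apply/orP; left; apply/word_containsP; exists h, x, y; split=> //.
  by rewrite shape_one_line lt_pih lt_pi (ltn_trans lt_pih lt_pi).
have lt_pi : pi y < pi x by rewrite perm_ltNge 1?eq_sym // -leqNgt.
have /existsP[h /andP[lt_hx lt_pih]] : down x.
  by rewrite eq_down; apply/existsP; exists x; rewrite lt_xy.
apply/orP; right; apply/word_containsP; exists h, x, y; split=> //.
rewrite shape_one_line !ltnNge ltnW //= (ltnW lt_pi).
by rewrite (ltnW (ltn_trans lt_pi lt_pih)).
Qed.

(** A permutation is increasing along its fixed points. *)
Lemma fixed_points_le2 n (pi : 'S_n) :
  ~~ word_contains [:: 1; 2; 3] (one_line pi) -> #|fixed_points pi| <= 2.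
Proof.
apply: contraNT; rewrite -ltnNge cardE.
have : sorted (relpre val ltn) (enum (fixed_points pi)).
  rewrite {1}/enum_mem; apply: sorted_filter => [j i k|]; first exact: ltn_trans.
  by rewrite -sorted_map -enumT val_enum_ord iota_ltn_sorted.
have fixed i : i \in enum (fixed_points pi) -> pi i = i.
  by rewrite mem_enum inE => /eqP.
case: (enum _) fixed => [|i [|j [|k s]]] //= fixed /and3P[lt_ij lt_jk _] _.
apply/word_containsP; exists i, j, k; split=> //.
rewrite shape_one_line !fixed ?inE ?eqxx ?orbT //.
by rewrite lt_ij lt_jk (ltn_trans lt_ij lt_jk).
Qed.

(** * Counting words *)

Lemma perm_one_line n (pi : 'S_n) : perm_eq (one_line pi) (iota 1 n).
Proof.
rewrite /one_line (map_comp S) -[1]addn0 iotaDl -val_enum_ord -map_comp.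
rewrite -(map_comp (addn 1)) [X in perm_eq X _](map_comp (S \o val) pi).
apply/perm_map/uniq_perm; rewrite ?(map_inj_uniq perm_inj) ?enum_uniq // => i.
by rewrite mem_enum -[i](permKV pi) map_f ?mem_enum.
Qed.

Lemma one_line_inj n : injective (@one_line n).
Proof.
move=> pi rho eq_line; apply/permP=> i; apply/val_inj/succn_inj.
by rewrite -!nth_one_line eq_line.
Qed.

Lemma card_one_line n (P : pred (seq nat)) :
  #|[set pi : 'S_n | P (one_line pi)]| = count P (permutations (iota 1 n)).
Proof.
have /seq.permP <- : perm_eq (map (@one_line n) (enum {: 'S_n}))
                         (permutations (iota 1 n)).
  apply: uniq_perm; rewrite ?(map_inj_uniq (@one_line_inj n)) ?enum_uniq //.
    exact: permutations_uniq.
  move=> s; rewrite mem_permutations; apply/mapP/idP => [[pi _ ->] | perm_s].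
    exact: perm_one_line.
  by exists (of_word n s); rewrite ?mem_enum ?one_line_of_word.
by rewrite cardsE cardE size_filter count_map -enumT.
Qed.

Definition word_fixed_points (s : seq nat) : nat :=
  count (fun i => nth 0 s i == i.+1) (iota 0 (size s)).

Lemma card_fixed_points n (pi : 'S_n) :
  #|fixed_points pi| = word_fixed_points (one_line pi).
Proof.
rewrite /word_fixed_points size_one_line -val_enum_ord count_map.
rewrite cardsE cardE size_filter enumT; apply: eq_count => i /=.
by rewrite nth_one_line eqSS.
Qed.

Definition word_admissible (w : seq nat) (k : nat) (s : seq nat) : bool :=
  [&& word_fixed_points s == k, ~~ word_contains [:: 1; 2; 3] s,
      ~~ word_contains w s & ~~ word_contains [:: 3; 2; 1] s].

Lemma S_one_line n k w : perm_eq w (iota 1 3) ->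
  S_ n k [fset p123; word_pattern 3 w; p321]
  = [set pi | word_admissible w k (one_line pi)].
Proof.
move=> perm_w; apply/setP=> pi; rewrite !inE card_fixed_points.
have avoidsE v : perm_eq v (iota 1 3) ->
    avoids (tagged (word_pattern 3 v)) pi = ~~ word_contains v (one_line pi).
  by move=> perm_v; rewrite /avoids contains_one_line one_line_of_word.
rewrite /word_admissible -!avoidsE //; congr (_ && _).
apply/forallP/and3P => [avoid | [av1 av2 av3] [tau tau_in] /=].
  have avoid_in tau (tau_in : tau \in [fset p123; word_pattern 3 w; p321]) :
    avoids (tagged tau) pi by apply: (avoid [` tau_in]).
  by split; apply: avoid_in; rewrite !inE eqxx ?orbT.
by move: (tau_in); rewrite !inE -orbA => /or3P[] /eqP->.
Qed.

Lemma s_count n k w : perm_eq w (iota 1 3) ->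
  s_ n k [fset p123; word_pattern 3 w; p321]
  = count (word_admissible w k) (permutations (iota 1 n)).
Proof. by move=> perm_w; rewrite /s_ S_one_line // card_one_line. Qed.

Lemma s_long n k w : perm_eq w (iota 1 3) -> 4 < n ->
  s_ n k [fset p123; word_pattern 3 w; p321] = 0.
Proof.
move=> perm_w n_gt4; rewrite /s_ S_one_line //; apply: eq_card0 => pi.
rewrite !inE; apply/and4P=> [[_ av123 _ av321]].
by have:= monotone_triple pi n_gt4; rewrite (negPf av123) (negPf av321).
Qed.

Lemma s_many_fixed_points n k w : perm_eq w (iota 1 3) -> 2 < k ->
  s_ n k [fset p123; word_pattern 3 w; p321] = 0.
Proof.
move=> perm_w k_gt2; rewrite /s_ S_one_line //; apply: eq_card0 => pi.
rewrite !inE; apply/and4P=> [[/eqP fix_k av123 _ _]].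
by have:= fixed_points_le2 av123; rewrite card_fixed_points fix_k leqNgt k_gt2.
Qed.

(** Both sides vanish for n > 4, on the left by [monotone_triple], so agreement
    on the first five lengths is enough. *)
Lemma s_table w k t : perm_eq w (iota 1 3) -> size t <= 5 ->
  all (fun n => count (word_admissible w k) (permutations (iota 1 n))
                == nth 0 t n) (iota 0 5) ->
  forall n, s_ n k [fset p123; word_pattern 3 w; p321] = nth 0 t n.
Proof.
move=> perm_w size_t /allP table n; have [n_le4 | n_gt4] := leqP n 4.
  by rewrite s_count //; apply/eqP/table; rewrite mem_iota.
by rewrite s_long // nth_default // (leq_trans size_t).
Qed.

Lemma word_pattern_inj n v w : perm_eq v (iota 1 n) -> perm_eq w (iota 1 n) ->
  word_pattern n v = word_pattern n w -> v = w.
Proof.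
move=> perm_v perm_w /(congr1 (fun p : pattern => one_line (tagged p))) /=.
by rewrite !one_line_of_word.
Qed.

Theorem theorem3p1 (alpha : pattern)
    (halpha : alpha \in [fset p132; p213; p231; p312]) :
  (alpha <> p231 /\ alpha <> p312 ->
     forall n : nat,
       s_ n 0 [fset p123; alpha; p321] = nth 0 [:: 1; 0; 1; 2; 1] n)
  /\ (alpha = p231 \/ alpha = p312 ->
     forall n : nat,
       s_ n 0 [fset p123; alpha; p321] = nth 0 [:: 1; 0; 1; 1; 1] n)
  /\ (alpha <> p132 /\ alpha <> p213 ->
     forall n : nat,
       s_ n 1 [fset p123; alpha; p321] = nth 0 [:: 0; 1; 0; 2] n)
  /\ (alpha = p132 \/ alpha = p213 ->
     forall n : nat,
       s_ n 1 [fset p123; alpha; p321] = nth 0 [:: 0; 1; 0; 1] n)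
  /\ (forall n : nat,
       s_ n 2 [fset p123; alpha; p321] = nth 0 [:: 0; 0; 1] n)
  /\ (forall n k : nat, 3 <= k <= n ->
       s_ n k [fset p123; alpha; p321] = 0).
Proof.
move: halpha; rewrite !inE -!orbA => /or4P[] /eqP->; do 5?split;
  try (by move=> n k /andP[k_gt2 _]; apply: s_many_fixed_points).
all: try (by apply: s_table; vm_compute).
(* Each implication left has a hypothesis comparing two explicit patterns: it is
   either refuted through one-line notations or selects the table to verify. *)
all: case; try (by []); try (by move/word_pattern_inj => /(_ isT isT)).
all: move=> *; by apply: s_table; vm_compute.
Qed.
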